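(* An irreducible semigroup $\mathcal S$ of real $d\times d$ matrices is c.s.r. if and only if there are a basis of $\mathbb R^d$ and a point $x\in\mathbb R^d$ such that, in this basis, $\|x\|_2=1$ and $\|Ax\|_2=1$ for all $A\in\mathcal S$. (Here ''in this basis'' means that all matrices $A\in\mathcal S$ are replaced by $T^{-1}AT$ for one invertible real matrix $T$, and $\|\cdot\|_2$ is the standard Euclidean norm of coordinate vectors.)
   Context: Matrix semigroups are multiplicative; the paper considers topologically closed semigroups. The spectral radius is the maximal modulus of eigenvalues. A matrix semigroup is c.s.r. (has constant spectral radius) if the spectral radius of all its elements is the same and nonzero. A family of $d\times d$ matrices is irreducible if there is no proper linear subspace of $\mathbb R^d$ (different from $\{0\}$ and $\mathbb R^d$) invariant for all matrices of the family. *)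

(* Defs.v *)
From mathcomp Require Import all_boot all_order all_algebra.
From mathcomp Require Import complex.
From mathcomp Require Import all_classical all_reals all_analysis.
Import Order.TTheory GRing.Theory Num.Theory numFieldNormedType.Exports.

Set Implicit Arguments.
Unset Strict Implicit.
Unset Printing Implicit Defensive.

Local Open Scope classical_set_scope.
Local Open Scope ring_scope.

(* For 0 < d the set of moduli is finite and nonempty, so the supremum is a
   maximum. MathComp's [eigenvalue] is phrased with row eigenvectors; a matrix
   and its transpose have the same eigenvalues. *)
Definition spectral_radius (R : realType) (d : nat) (A : 'M[R]_d) : R :=
  sup [set ComplexField.Normc.normc z | z in
        [set z : R[i] | eigenvalue (map_mx (real_complex R) A) z]].

Definition matrix_semigroup (R : realType) (d : nat) (S : set 'M[R]_d) : Prop :=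
  forall A B : 'M[R]_d, S A -> S B -> S (A *m B).

Definition constant_spectral_radius (R : realType) (d : nat)
    (S : set 'M[R]_d) : Prop :=
  exists2 r : R, r != 0 & forall A, S A -> spectral_radius A = r.

Definition irreducible_family (R : realType) (d : nat)
    (S : set 'M[R]_d) : Prop :=
  forall U : {vspace 'cV[R]_d},
    (forall (A : 'M[R]_d) (v : 'cV[R]_d), S A -> v \in U -> A *m v \in U) ->
    U = 0%VS \/ U = fullv.

(* The library norm on matrices is the sup norm, hence this definition. *)
Definition euclidean_norm (R : realType) (d : nat) (x : 'cV[R]_d) : R :=
  Num.sqrt (\sum_(i < d) x i ord0 ^+ 2).

(* Main.v *)
Require Import Defs.
From mathcomp Require Import all_boot all_order all_algebra.
From mathcomp Require Import complex ring lra.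
From mathcomp Require Import all_classical all_reals all_analysis.
Import Order.TTheory GRing.Theory Num.Theory numFieldNormedType.Exports.

Set Implicit Arguments.
Unset Strict Implicit.
Unset Printing Implicit Defensive.

Local Open Scope classical_set_scope.
Local Open Scope ring_scope.

(* Constant spectral radius => invariant norm. The radius is at most 1, so traces
   are bounded on S; as the trace form is nondegenerate on the span of an
   irreducible S, the closed set S is compact, and it misses 0. Let E be an
   idempotent of minimal rank in S: E S E is a bounded group with unit E, hence it
   preserves a nonzero semidefinite form M = E^T M E. For x in the range of E and
   A in S, M(Ax) = M(EAE x) = M(x); the same holds for every form M(B _) with B
   in S, and by irreducibility finitely many of these add up to a definite form,
   which Cholesky turns into the Euclidean one.
   Conversely, orbits of x being bounded and bounded away from 0 forces the
   largest eigenvalue modulus of each A in S to be exactly 1. *)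

(** * Compactness and continuity for matrices *)

(** Members of a chain form a filter base; a cluster point of the generated filter lies in each
    member because the members are closed. *)
Lemma compact_chain (T : topologicalType) (K : set T) (F : set (set T)) :
  compact K -> F !=set0 -> total_on F subset ->
  (forall X, F X -> [/\ closed X, X !=set0 & X `<=` K]) ->
  \bigcap_(X in F) X !=set0.
Proof.
move=> cK [X0 FX0] totF FP.
have FF : ProperFilter (filter_from F id).
  apply: filter_from_proper; last by move=> X /FP[].
  apply: filter_from_filter; first by exists X0.
  move=> X Y FX FY; have [XY|YX] := totF _ _ FX FY.
    by exists X => // x Xx; split=> //; exact: XY.
  by exists Y => // y Yy; split=> //; exact: YX.
have [|p [_ clp]] := cK _ FF; first by exists X0 => //; have [] := FP _ FX0.
exists p => X FX; have [clX _ _] := FP _ FX.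
by apply: clX => B Bp; apply: clp => //; exists X.
Qed.

Section MatrixTopology.
Variable R : realType.

Lemma continuous_mx (T : topologicalType) m n (f : T -> 'M[R]_(m, n)) :
  (forall i j, continuous (fun t => f t i j)) -> continuous f.
Proof.
move=> fc t A [P nP PA].
have : \forall u \near t, forall ij : 'I_m * 'I_n, P ij.1 ij.2 (f u ij.1 ij.2).
  apply: filter_forall => -[i j] /=.
  exact: (fc i j t _ (nP i j)).
by apply: filterS => u Pu; apply: PA => i j; exact: (Pu (i, j)).
Qed.

Lemma continuous_mxE (T : topologicalType) m n (f : T -> 'M[R]_(m, n)) i j :
  continuous f -> continuous (fun t => f t i j).
Proof.
move=> fc t; apply: (@continuous_comp _ _ _ f (fun M => M i j)); first exact: fc.
exact: coord_continuous.
Qed.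

Lemma continuous_sumr (T : topologicalType) (I : Type) (r : seq I)
    (F : I -> T -> R) :
  (forall i, continuous (F i)) -> continuous (fun t => \sum_(i <- r) F i t).
Proof.
move=> Fc; apply: continuous_big => [|i _]; last exact: Fc.
exact: add_continuous.
Qed.

Lemma continuous_mulmx (T : topologicalType) m n p
    (f : T -> 'M[R]_(m, n)) (g : T -> 'M[R]_(n, p)) :
  continuous f -> continuous g -> continuous (fun t => f t *m g t).
Proof.
move=> fc gc; apply: continuous_mx => i j.
rewrite (_ : (fun _ => _) = fun t => \sum_k f t i k * g t k j); last first.
  by apply/funext => t; rewrite mxE.
apply: continuous_sumr => k t.
by apply: continuousM; apply: continuous_mxE.
Qed.

Lemma continuous_mxtrace (T : topologicalType) n (f : T -> 'M[R]_n) :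
  continuous f -> continuous (fun t => \tr (f t)).
Proof. by move=> fc; apply: continuous_sumr => i; exact: continuous_mxE. Qed.

Lemma continuous_trmx (T : topologicalType) m n (f : T -> 'M[R]_(m, n)) :
  continuous f -> continuous (fun t => (f t)^T).
Proof.
move=> fc; apply: continuous_mx => i j.
rewrite (_ : (fun _ => _) = fun t => f t j i); last first.
  by apply/funext => t; rewrite mxE.
exact: continuous_mxE.
Qed.

Lemma closed_ge_fun (T : topologicalType) (f : T -> R) c :
  continuous f -> closed [set t | c <= f t].
Proof. by move=> /continuous_closedP/(_ _ (closed_ge (y := c))). Qed.

Lemma closed_le_fun (T : topologicalType) (f : T -> R) c :
  continuous f -> closed [set t | f t <= c].
Proof. by move=> /continuous_closedP/(_ _ (closed_le (y := c))). Qed.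

Lemma closed_eq_mx (T : topologicalType) m n (f g : T -> 'M[R]_(m, n)) :
  continuous f -> continuous g -> closed [set t | f t = g t].
Proof.
move=> fc gc.
have -> : [set t | f t = g t] =
    \bigcap_ij [set t | f t ij.1 ij.2 - g t ij.1 ij.2 = 0].
  apply/seteqP; split=> t /= fg.
    by move=> ij _ /=; rewrite fg subrr.
  by apply/matrixP => i j; apply/subr0_eq; exact: (fg (i, j)).
apply: closed_bigI => -[i j] _ /=.
have c : continuous (fun t => f t i j - g t i j).
  by move=> t; apply: continuousB; apply: continuous_mxE.
by have /continuous_closedP/(_ _ (closed_eq (y := 0))) := c.
Qed.

(** Flattening by [vec_mx] reduces this to row vectors, where a product of segments is compact. *)
Lemma compact_mx m n (K : set 'M[R]_(m, n)) (C : R) :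
  closed K -> (forall A, K A -> forall i j, `|A i j| <= C) -> compact K.
Proof.
move=> clK bK.
have vc : continuous (@vec_mx R m n).
  apply: continuous_mx => i j.
  rewrite (_ : (fun _ => _) = fun t : 'rV_(m * n) => t ord0 (mxvec_index i j)).
    exact: coord_continuous.
  by apply/funext => t; rewrite mxE.
have -> : K = vec_mx @` (vec_mx @^-1` K).
  apply/seteqP; split=> [A KA|_ [v Kv <-] //].
  by exists (mxvec A); rewrite /= ?mxvecK.
apply: continuous_compact; first exact: continuous_subspaceT.
have cl : closed (vec_mx @^-1` K) by have /continuous_closedP/(_ _ clK) := vc.
have cc := @rV_compact R (m * n) (fun=> `[(- C), C]%classic)
  (fun=> @segment_compact _ _ _).
apply: subclosed_compact cl cc _ => v Kv k /=.
case/mxvec_indexP: k => i j.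
have := bK _ Kv i j; rewrite mxE ler_norml => /andP[h1 h2].
by rewrite in_itv /= h1 h2.
Qed.

Lemma compact_mx_closed m n (K : set 'M[R]_(m, n)) : compact K -> closed K.
Proof. by apply: compact_closed; exact: norm_hausdorff. Qed.

Lemma compact_mx_bounded m n (K : set 'M[R]_(m, n)) :
  compact K -> exists C, forall A, K A -> forall i j, `|A i j| <= C.
Proof.
move=> /compact_bounded[C [_ bC]]; exists (C + 1) => A KA i j.
apply: le_trans (bC _ _ _ KA); last by rewrite ltrDl.
rewrite [leRHS]/Num.norm /= mx_normrE.
by apply/bigmax_geP; right => /=; exists (i, j).
Qed.

End MatrixTopology.

(** * Compact matrix semigroups *)

(* Ellis' argument: a minimal closed subsemigroup L satisfies aL = L for each
   of its elements a, and then {k in L | ak = a} is all of L. *)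
Lemma compact_semigroup_idempotent (R : realType) n (K : set 'M[R]_n) :
  compact K -> K !=set0 -> matrix_semigroup K -> exists2 E, K E & E *m E = E.
Proof.
move=> cK K0 sK.
pose sub (L : set 'M[R]_n) :=
  [/\ closed L, L !=set0, matrix_semigroup L & L `<=` K].
have subK : sub K by split=> //; exact: compact_mx_closed.
(* [Zorn_bigcup] yields maximal sets, so it is applied to the sets whose removal from [K] leaves a
   closed subsemigroup; compactness keeps the intersection of a chain of these subsemigroups
   nonempty. *)
have [F FP totF|A [subA maxA]] := @Zorn_bigcup _ [set A | sub (K `\` A)].
  rewrite /= setDE setC_bigcup.
  have [F0|/set0P[X0 FX0]] := eqVneq F set0.
    by rewrite F0 bigcap_set0 setIT.
  have I0 : \bigcap_(X in [set K `\` X | X in F]) X !=set0.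
    apply: compact_chain cK _ _ _.
    - by exists (K `\` X0); exists X0.
    - move=> _ _ [X FX <-] [Y FY <-].
      by have [XY|YX] := totF _ _ FX FY; [right|left]; exact: setDS.
    - by move=> _ [X FX <-]; have [] := FP _ FX.
  have eqI : K `&` \bigcap_(X in F) ~` X = \bigcap_(X in [set K `\` X | X in F]) X.
    apply/seteqP; split=> [A [KA FA] _ [X FX <-]|A FA].
      by split=> //; exact: FA.
    split; first by case: (FA (K `\` X0)); [exists X0|].
    by move=> X FX; case: (FA (K `\` X)); [exists X|].
  rewrite eqI; split=> //.
  - by apply: closed_bigI => _ [X FX <-]; have [] := FP _ FX.
  - move=> A B FA FB _ [X FX <-]; have [_ _ sX _] := FP _ FX.
    by apply: sX; [apply: FA|apply: FB]; exists X.
  - by rewrite -eqI; exact: subIsetl.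
have minA L : sub L -> L `<=` K `\` A -> L = K `\` A.
  move=> [clL L0 sL LK] LA.
  have LE : K `\` ~` L = L by rewrite setDE setCK setIidr.
  have AL : A `<=` ~` L by move=> x Ax Lx; have [_ /(_ Ax)] := LA _ Lx.
  have -> : A = ~` L; last by rewrite LE.
  apply: contrapT => neq; apply: (maxA (~` L)); last by rewrite /= LE.
  by split=> // LA'; apply: neq; exact/seteqP.
case: (subA) => clL [a La] sL LK.
have cL : compact (K `\` A) by apply: subclosed_compact clL cK _.
have aL : [set a *m k | k in K `\` A] = K `\` A.
  apply: minA; last by move=> _ [k Lk <-]; exact: sL.
  split.
  - apply: compact_mx_closed; apply: continuous_compact => //.
    apply: continuous_subspaceT.
    by apply: continuous_mulmx => ?; [exact: cst_continuous|exact: cvg_id].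
  - by exists (a *m a); exists a.
  - move=> _ _ [k Lk <-] [l Ll <-]; exists (k *m (a *m l)); last by rewrite !mulmxA.
    by apply: (sL _ _ Lk); exact: sL.
  - by move=> _ [k Lk <-]; apply: LK; exact: sL.
have aK : (K `\` A) `&` [set k | a *m k = a] = K `\` A.
  apply: minA; last exact: subIsetl.
  split.
  - apply: closedI => //; apply: closed_eq_mx => [|?]; last exact: cst_continuous.
    by apply: continuous_mulmx => ?; [exact: cst_continuous|exact: cvg_id].
  - have : [set a *m k | k in K `\` A] a by rewrite aL.
    by case=> k Lk ak; exists k.
  - by move=> k l [Lk /= ak] [Ll /= al]; split; [exact: sL|rewrite /= mulmxA ak].
  - by move=> k [Lk _]; exact: LK.
exists a; first exact: LK.
by have [] : ((K `\` A) `&` [set k | a *m k = a]) a by rewrite aK.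
Qed.

(** The idempotent is found in A S with A of minimal rank, so it has minimal rank too. A second
    idempotent F, found in G (E S E) for G = E g E, satisfies E F = F E = F and cannot have smaller
    rank, which forces F = E and makes G invertible. *)
Lemma minimal_rank_idempotent (R : realType) n (S : set 'M[R]_n) :
  compact S -> S !=set0 -> matrix_semigroup S ->
  exists E, [/\ S E, E *m E = E & forall A, S A ->
    exists B, [/\ S B & (E *m A *m E) *m (E *m B *m E) = E]].
Proof.
move=> cS [A0 SA0] sS.
have [A [SA minA]] : exists A, S A /\ forall B, S B -> (\rank A <= \rank B)%N.
  have exr : exists r, `[< exists2 A, S A & \rank A = r >].
    by exists (\rank A0); apply/asboolP; exists A0.
  have [_ /asboolP[A SA <-] minr] := ex_minnP exr.
  by exists A; split=> // B SB; apply: minr; apply/asboolP; exists B.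
have image (f : 'M[R]_n -> 'M[R]_n) : continuous f -> compact (f @` S).
  by move=> fc; apply: continuous_compact => //; exact: continuous_subspaceT.
have cstc (B : 'M[R]_n) : continuous (fun _ : 'M[R]_n => B).
  by move=> ?; exact: cst_continuous.
have idc : continuous (fun B : 'M[R]_n => B) by move=> ?; exact: cvg_id.
have [||| _ [B SB <-] idE] := @compact_semigroup_idempotent _ _ (mulmx A @` S).
- by apply: image; exact: continuous_mulmx.
- by exists (A *m A); exists A.
- move=> _ _ [B SB <-] [C SC <-]; exists (B *m (A *m C)); last by rewrite !mulmxA.
  by apply: (sS _ _ SB); exact: sS.
set E := A *m B in idE *; have SE : S E by exact: sS.
have rkE C : S C -> (\rank E <= \rank C)%N.
  by move=> SC; apply: leq_trans (minA _ SC); rewrite mxrankM_maxl.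
clearbody E; exists E; split=> // g Sg; set G := E *m g *m E.
have SG : S G := sS _ _ (sS _ _ SE Sg) SE.
have [|||_ [C SC <-] idF] :=
    @compact_semigroup_idempotent _ _ ((fun C => G *m (E *m C *m E)) @` S).
- apply: image; apply: continuous_mulmx => //.
  by do 2?apply: continuous_mulmx.
- by exists (G *m (E *m g *m E)); exists g.
- move=> _ _ [C SC <-] [D SD <-].
  exists (C *m E *m G *m E *m D).
    exact: (sS _ _ (sS _ _ (sS _ _ (sS _ _ SC SE) SG) SE) SD).
  by rewrite !mulmxA.
exists C; split=> //; set F := G *m _ in idF *.
have SF : S F by apply: (sS _ _ SG); exact: (sS _ _ (sS _ _ SE SC) SE).
have EF : E *m F = F by rewrite /F /G !mulmxA idE.
have FE : F *m E = F by rewrite /F -!mulmxA idE.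
(* Equal ranks make the row spaces equal, so E = D F for some D, and F = E F = D F F = D F = E. *)
have FleE : (F <= E)%MS by rewrite -FE submxMl.
have := mxrank_leqif_eq FleE.
move=> /geq_leqif; rewrite rkE// => /esym/andP[_ /submxP[D ED]].
by rewrite -EF {1}ED -mulmxA idF.
Qed.

(** * Forms invariant under a bounded group *)

(* The square of the Frobenius norm. *)
Definition frob (R : realType) m n (X : 'M[R]_(m, n)) : R := \tr (X^T *m X).

(** * The Frobenius norm *)

Section Frobenius.
Variable R : realType.

(** A crude bound that avoids square roots, for places where only boundedness of entries matters. *)
Lemma normr_le_sqrD1 (x K : R) : x ^+ 2 <= K -> `|x| <= K + 1.
Proof.
rewrite -real_normK ?num_real//; move: `|x| (normr_ge0 x) => y y0 yK.
by have := sqr_ge0 (y - 1); nra.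
Qed.

Lemma frobE m n (X : 'M[R]_(m, n)) : frob X = \sum_j \sum_i X i j ^+ 2.
Proof.
apply: eq_bigr => j _; rewrite mxE; apply: eq_bigr => i _.
by rewrite mxE expr2.
Qed.

Lemma frob_ge0 m n (X : 'M[R]_(m, n)) : 0 <= frob X.
Proof. by rewrite frobE; do 2![apply: sumr_ge0 => ? _]; exact: sqr_ge0. Qed.

Lemma frob_ge_entry m n (X : 'M[R]_(m, n)) i j : X i j ^+ 2 <= frob X.
Proof.
have ge0 k l : 0 <= X k l ^+ 2 by exact: sqr_ge0.
rewrite frobE (bigD1 j)//= (bigD1 i)//= -addrA lerDl.
by rewrite addr_ge0// ?sumr_ge0// => k _; exact: sumr_ge0.
Qed.

Lemma frob_le0 m n (X : 'M[R]_(m, n)) : frob X <= 0 -> X = 0.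
Proof.
move=> X0; apply/matrixP => i j; rewrite mxE; apply/eqP.
by rewrite -sqrf_eq0 eq_le sqr_ge0 andbT (le_trans (frob_ge_entry _ _ _)).
Qed.

Lemma frob_tr m n (X : 'M[R]_(m, n)) : frob X^T = frob X.
Proof. by rewrite /frob trmxK mxtrace_mulC. Qed.

Lemma frobZ m n a (X : 'M[R]_(m, n)) : frob (a *: X) = a ^+ 2 * frob X.
Proof.
by rewrite /frob [(_ *: X)^T]linearZ /= -scalemxAl -scalemxAr scalerA mxtraceZ expr2.
Qed.

(** The parallelogram law, read as strict convexity: the midpoint gains a definite amount unless X =
    Y. *)
Lemma frob_mid m n (X Y : 'M[R]_(m, n)) :
  frob (2^-1 *: (X + Y)) = (frob X + frob Y) / 2 - frob (X - Y) / 4.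
Proof.
have trYX : \tr (Y^T *m X) = \tr (X^T *m Y).
  by rewrite -mxtrace_tr trmx_mul trmxK.
rewrite frobZ /frob [(X + Y)^T]linearD [(X - Y)^T]linearB /=.
rewrite !mulmxDl !mulmxDr !mulNmx !mulmxN !mxtraceD !(raddfN mxtrace) /= trYX.
by field.
Qed.

Lemma cauchy_schwarz_sum (I : finType) (a b : I -> R) :
  (\sum_i a i * b i) ^+ 2 <= (\sum_i a i ^+ 2) * (\sum_i b i ^+ 2).
Proof.
rewrite -subr_ge0 -(pmulr_rge0 _ (ltr0n R 2)).
(* Lagrange's identity. *)
suff -> : 2 * ((\sum_i a i ^+ 2) * (\sum_i b i ^+ 2) - (\sum_i a i * b i) ^+ 2)
  = \sum_i \sum_j (a i * b j - a j * b i) ^+ 2.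
  by do 2![apply: sumr_ge0 => ? _]; exact: sqr_ge0.
have sq (f g : I -> R) : (\sum_i f i) * (\sum_j g j) = \sum_i \sum_j f i * g j.
  by rewrite mulr_suml; apply: eq_bigr => i _; rewrite mulr_sumr.
rewrite mulrBr mulr_natl mulr2n [X in X + _ - _]sq.
rewrite [X in _ + X - _]mulrC sq expr2 sq mulr_sumr -big_split -sumrB /=.
apply: eq_bigr => i _; rewrite mulr_sumr -big_split -sumrB /=.
by apply: eq_bigr => j _; ring.
Qed.

Lemma frobM m n p (X : 'M[R]_(m, n)) (Y : 'M[R]_(n, p)) :
  frob (X *m Y) <= frob X * frob Y.
Proof.
rewrite -[frob X]frob_tr !frobE mulr_sumr; apply: ler_sum => j _.
rewrite mulr_suml; apply: ler_sum => i _; rewrite mxE.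
apply: le_trans (cauchy_schwarz_sum _ _) _.
by apply: ler_wpM2r; [apply: sumr_ge0 => k _; exact: sqr_ge0|
  apply: ler_sum => k _; rewrite mxE].
Qed.

End Frobenius.

(* Among the positive semidefinite forms M = E^T M E with tr (g^T M g) >= 1 for
   all g, the minimiser of sup_g |g^T M g| in the Frobenius norm is unique by the
   parallelogram law, hence invariant. *)
Lemma bounded_group_invariant_form (R : realType) n (G : set 'M[R]_n)
    (E : 'M[R]_n) (c : R) :
  E != 0 -> G E -> matrix_semigroup G ->
  (forall g, G g -> E *m g = g /\ g *m E = g) ->
  (forall g, G g -> exists2 h, G h & g *m h = E) ->
  (forall g, G g -> frob g <= c) ->
  exists M : 'M[R]_n, [/\ M^T = M, forall v : 'cV_n, 0 <= \tr (v^T *m M *m v),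
    M != 0 & forall g, G g -> g^T *m M *m g = M].
Proof.
move=> E0 GE sG GEg invG bG.
have frobE0 : 0 < frob E.
  by rewrite lt_neqAle frob_ge0 andbT eq_sym; apply: contra_neq E0 => h;
     apply: frob_le0; rewrite h.
have c0 : 0 < c by exact: lt_le_trans (bG _ GE).
have idE : E *m E = E by have [] := GEg _ GE.
(* All conditions are closed and convex. The equation E^T M E = M lets a bound at g = E control [M]
   itself, and the trace condition keeps [M] away from 0. *)
pose K : set 'M[R]_n := [set M | [/\ M^T = M,
  forall v : 'cV_n, 0 <= \tr (v^T *m M *m v), E^T *m M *m E = M &
  forall g, G g -> 1 <= \tr (g^T *m M *m g)]].
pose Kt t := [set M | K M /\ forall g, G g -> frob (g^T *m M *m g) <= t].
(* Acting by [g] is undone by acting by its inverse, whose norm is bounded by [c]; hence two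
   distinct forms stay apart uniformly in g. *)
have frobG g D : G g -> E^T *m D *m E = D ->
    frob D <= c ^+ 2 * frob (g^T *m D *m g).
  move=> Gg ED; have [h Gh gh] := invG _ Gg.
  rewrite -{1}ED -gh trmx_mul.
  rewrite (_ : _ *m _ = h^T *m (g^T *m D *m g) *m h); last by rewrite !mulmxA.
  apply: le_trans (frobM _ _) _.
  apply: le_trans (ler_wpM2r (frob_ge0 _) (frobM _ _)) _.
  rewrite frob_tr mulrAC; apply: ler_wpM2r; first exact: frob_ge0.
  by rewrite expr2; apply: ler_pM; rewrite ?frob_ge0 ?bG.
have conjc (P Q : 'M[R]_n) : continuous (fun M => P *m M *m Q).
  apply: continuous_mulmx => [|?]; last exact: cst_continuous.
  by apply: continuous_mulmx => ?; [exact: cst_continuous|exact: cvg_id].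
have clKt t : closed (Kt t).
  have -> : Kt t = [set M | M^T = M]
      `&` \bigcap_(v : 'cV_n) [set M | 0 <= \tr (v^T *m M *m v)]
      `&` [set M | E^T *m M *m E = M]
      `&` \bigcap_(g in G) [set M | 1 <= \tr (g^T *m M *m g)]
      `&` \bigcap_(g in G) [set M | frob (g^T *m M *m g) <= t].
    apply/seteqP; split=> M /=.
      move=> [[h1 h2 h3 h4] h5].
      exact: (conj (conj (conj (conj h1 (fun v _ => h2 v)) h3) h4) h5).
    move=> [[[[h1 h2] h3] h4] h5].
    exact: (conj (And4 h1 (fun v => h2 v I) h3 h4) h5).
  have idc : continuous (fun M : 'M[R]_n => M) by move=> ?; exact: cvg_id.
  repeat apply: closedI.
  - by apply: closed_eq_mx => //; exact: continuous_trmx.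
  - apply: closed_bigI => v _; apply: closed_ge_fun; apply: continuous_mxtrace.
    apply: continuous_mulmx => [|?]; last exact: cst_continuous.
    by apply: continuous_mulmx => ?; [exact: cst_continuous|exact: cvg_id].
  - exact: closed_eq_mx.
  - by apply: closed_bigI => g _; apply: closed_ge_fun; exact: continuous_mxtrace.
  - apply: closed_bigI => g _; apply: closed_le_fun; apply: continuous_mxtrace.
    by apply: continuous_mulmx => //; exact: continuous_trmx.
have Kt_ge0 t M : Kt t M -> 0 <= t.
  by move=> [_ /(_ _ GE)]; apply: le_trans; exact: frob_ge0.
have leKt s t : s <= t -> Kt s `<=` Kt t.
  by move=> st M [KM Ms]; split=> // g Gg; exact: le_trans (Ms _ Gg) st.
have cKt t : compact (Kt t).
  apply: (@compact_mx _ _ _ _ (t + 1)) (clKt _) _ => M KM i j.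
  case: KM => -[_ _ EM _] /(_ _ GE); rewrite EM => Mt.
  by apply: normr_le_sqrD1; exact: le_trans (frob_ge_entry _ _ _) Mt.
pose T := [set t | Kt t !=set0].
have T0 : T !=set0.
  (* Since frob E <= frob g * frob h <= c * frob g when g h = E, the multiple [a] of E^T E has
     traces at least 1 along the group. *)
  pose a := c / frob E; have a0 : 0 < a by exact: divr_gt0.
  exists (a ^+ 2 * c ^+ 2); exists (a *: (E^T *m E)).
  have conjg g : G g ->
      g^T *m (a *: (E^T *m E)) *m g = a *: (g^T *m g).
    move=> Gg; rewrite -scalemxAr -scalemxAl.
    rewrite (_ : _ *m _ *m _ = (E *m g)^T *m (E *m g)); first by have [->] := GEg _ Gg.
    by rewrite trmx_mul !mulmxA.
  split; last first.
    move=> g Gg; rewrite conjg// frobZ ler_wpM2l ?sqr_ge0//.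
    apply: le_trans (frobM _ _) _; rewrite frob_tr expr2.
    by apply: ler_pM; rewrite ?frob_ge0 ?bG.
  split.
  - by rewrite linearZ /= trmx_mul trmxK.
  - move=> v; rewrite -scalemxAr -scalemxAl mxtraceZ pmulr_rge0//.
    have := frob_ge0 (E *m v); rewrite /frob trmx_mul.
    by rewrite !mulmxA.
  - by rewrite conjg.
  - move=> g Gg; rewrite conjg// mxtraceZ -/(frob g).
    have [h Gh gh] := invG _ Gg.
    rewrite /a mulrAC ler_pdivlMr// mul1r -gh.
    apply: le_trans (frobM _ _) _; rewrite mulrC.
    by apply: ler_wpM2r; [exact: frob_ge0|exact: bG].
have lbT : has_lbound T by exists 0 => t [M /Kt_ge0].
have infT : has_inf T by [].
set m := inf T.
(* The infimum is attained: the sublevel sets [Kt t] with m < t <= m + 1 are a chain of nonempty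
   compact sets, and a common point lies in [Kt m]. *)
have [M KM] : Kt m !=set0.
  have [|||M FM] := @compact_chain _ (Kt (m + 1))
      [set Kt t | t in [set t | m < t <= m + 1]] (cKt _).
  - by exists (Kt (m + 1)); exists (m + 1) => //=; rewrite ltrDl ltr01 lexx.
  - move=> _ _ [s _ <-] [t _ <-].
    by have [st|/ltW ts] := leP s t; [left|right]; exact: leKt.
  - move=> _ [t /= /andP[mt tm] <-]; split=> //; last exact: leKt.
    have tm0 : 0 < t - m by rewrite subr_gt0.
    have [s [M KM] st] := inf_adherent tm0 infT.
    exists M; apply: leKt KM.
    by apply: ltW; move: st; rewrite -/m addrC subrK.
  - exists M; split.
      have [|//] := FM (Kt (m + 1)); exists (m + 1) => //=.
      by rewrite ltrDl ltr01 lexx.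
    move=> g Gg; apply/ler_addgt0Pr => e e0.
    have [|_ h] := FM (Kt (m + Num.min e 1)).
      exists (m + Num.min e 1) => //=.
      by rewrite ltrDl lt_min e0 ltr01 lerD2l ge_min lexx orbT.
    by apply: le_trans (h _ Gg) _; rewrite lerD2l ge_min lexx.
have uniq N : Kt m N -> N = M.
  move=> KN; apply/eqP; rewrite -subr_eq0; apply/eqP; apply: frob_le0.
  case: KM => -[Msym Mpos ME M1] Mm; case: KN => -[Nsym Npos NE N1] Nm.
  (* The midpoint of two minimisers lowers every value by at least [d], by [frob_mid] and
     [frobG]. *)
  pose d := frob (N - M) / c ^+ 2 / 4.
  suff : m <= m - d.
    rewrite -subr_ge0 addrAC subrr add0r oppr_ge0 /d !pmulr_lle0//.
    by rewrite invr_gt0 exprn_gt0.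
  apply: ge_inf => //; exists (2^-1 *: (N + M)).
  have conjP p q (P : 'M[R]_(p, n)) (Q : 'M[R]_(n, q)) : P *m (2^-1 *: (N + M)) *m Q =
      2^-1 *: (P *m N *m Q + P *m M *m Q).
    by rewrite -scalemxAr -scalemxAl mulmxDr mulmxDl.
  split; last first.
    move=> g Gg; rewrite conjP frob_mid lerB//.
      have := Mm _ Gg; have := Nm _ Gg; lra.
    rewrite /d ler_pM2r// ler_pdivrMr ?exprn_gt0// mulrC.
    rewrite -mulmxBl -mulmxBr; apply: frobG => //.
    by rewrite mulmxBr mulmxBl NE ME.
  split.
  - by rewrite linearZ linearD /= Nsym Msym.
  - move=> v; rewrite conjP mxtraceZ mxtraceD.
    by rewrite mulr_ge0// addr_ge0.
  - by rewrite conjP NE ME.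
  - move=> g Gg; rewrite conjP mxtraceZ mxtraceD.
    have := M1 _ Gg; have := N1 _ Gg; lra.
case: (KM) => -[Msym Mpos ME M1] Mm.
exists M; split=> //.
  apply: contraTneq (M1 _ GE) => ->.
  by rewrite mulmx0 mul0mx mxtrace0 ler10.
(* Replacing [M] by h^T M h only replaces g by [h *m g], which is again in [G], so the new form is a
   minimiser as well. *)
move=> h Gh; apply: uniq.
have conjh p (P : 'M[R]_(n, p)) :
    P^T *m (h^T *m M *m h) *m P = (h *m P)^T *m M *m (h *m P).
  by rewrite trmx_mul !mulmxA.
split; last by move=> g Gg; rewrite conjh; apply: Mm; exact: sG.
split.
- by rewrite !trmx_mul trmxK Msym mulmxA.
- by move=> v; rewrite conjh.
- by rewrite conjh; have [_ ->] := GEg _ Gh.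
- by move=> g Gg; rewrite conjh; apply: M1; exact: sG.
Qed.

(** * Definite and semidefinite forms *)

(** Induction on the size. The Schur complement [D] of the corner entry is again definite, since its
    value at w is the value of [Q] at the vector whose first coordinate cancels the mixed terms. *)
Lemma cholesky (R : realType) n (Q : 'M[R]_n) :
  Q^T = Q -> (forall v : 'cV_n, v != 0 -> 0 < \tr (v^T *m Q *m v)) ->
  exists2 L : 'M[R]_n, L \in unitmx & Q = L^T *m L.
Proof.
elim: n Q => [|n IHn] Q Qsym Qpos.
  by exists 1%:M; [exact: unitmx1|apply/matrixP => -[]].
rewrite -[n.+1]/(1 + n)%N in Q Qsym Qpos *.
set b := ursubmx Q; set C := drsubmx Q.
pose a := ulsubmx Q 0 0.
have EQ : Q = block_mx a%:M b b^T C.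
  rewrite -[LHS]submxK -mx11_scalar; congr block_mx.
  by rewrite trmx_ursub Qsym.
have a0 : 0 < a.
  pose v : 'cV[R]_(1 + n) := col_mx 1%:M 0.
  have v0 : v != 0.
    apply/eqP => /(congr1 usubmx); rewrite col_mxKu linear0 => /matrixP/(_ 0 0).
    by rewrite !mxE eqxx => /eqP; rewrite oner_eq0.
  have := Qpos v v0; rewrite EQ tr_col_mx mul_row_block mul_row_col !trmx0.
  by rewrite !mul0mx !mulmx0 !addr0 trmx1 mul1mx mulmx1 mxtrace_scalar mulr1n.
pose D := C - a^-1 *: (b^T *m b).
have Csym : C^T = C by rewrite trmx_drsub Qsym.
have [||L Lu DL] := IHn D.
- by rewrite linearB linearZ /= trmx_mul trmxK Csym.
- move=> w w0; pose v : 'cV[R]_(1 + n) := col_mx (- (a^-1 *: (b *m w))) w.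
  have v0 : v != 0.
    apply: contra_neq w0 => /(congr1 dsubmx).
    by rewrite col_mxKd linear0.
  have := Qpos v v0; rewrite EQ tr_col_mx mul_row_block mul_row_col.
  congr (0 < \tr _); rewrite [(- _)^T]linearN /=.
  rewrite (_ : (a^-1 *: (b *m w))^T = a^-1 *: (w^T *m b^T)); last first.
    by rewrite linearZ /= trmx_mul.
  rewrite !mulNmx.
 
  rewrite mul_mx_scalar scalerA divff ?gt_eqF// scale1r addNr mul0mx add0r.
  by rewrite /D mulmxBr -scalemxAr -scalemxAl addrC !mulmxA.
pose s := Num.sqrt a.
have s0 : s != 0 by rewrite sqrtr_eq0 -ltNge.
have ss : s * s = a by rewrite -expr2 sqr_sqrtr// ltW.
exists (block_mx s%:M (s^-1 *: b) 0 L).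
  by rewrite unitmxE det_ublock unitrM -!unitmxE Lu andbT unitmxE det_scalar1 unitfE.
rewrite tr_block_mx mulmx_block !trmx0 !mulmx0 !mul0mx !addr0 tr_scalar_mx.
rewrite -scalar_mxM ss EQ; congr block_mx.
- by rewrite mul_scalar_mx scalerA divff// scale1r.
- by rewrite mul_mx_scalar linearZ /= scalerA divff// scale1r.
- rewrite -DL [(s^-1 *: b)^T]linearZ /= -scalemxAl -scalemxAr scalerA -invfM ss /D addrC.
  by rewrite subrK.
Qed.

Section QuadraticForm.
Variables (R : realType) (n : nat) (M : 'M[R]_n).
Hypotheses (M_sym : M^T = M).
Hypotheses (M_psd : forall v : 'cV_n, 0 <= \tr (v^T *m M *m v)).

(** On the line v + t M v the form equals 2 t |M v|^2 + t^2 q, which is negative for some small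
    negative t unless M v = 0. *)
Lemma psd_null (v : 'cV_n) : \tr (v^T *m M *m v) = 0 -> M *m v = 0.
Proof.
move=> qv; set w := M *m v; set q := \tr (w^T *m M *m w).
have q0 : 0 <= q by exact: M_psd.
have ineq t : 0 <= 2 * t * frob w + t ^+ 2 * q.
  have := M_psd (v + t *: w).
  have -> : (v + t *: w)^T = v^T + t *: w^T by rewrite linearD linearZ.
  rewrite !mulmxDl !mulmxDr -!scalemxAl -!scalemxAr.
  rewrite !mxtraceD !mxtraceZ qv add0r -/q.
  have -> : v^T *m M *m w = w^T *m w by rewrite -[in v^T *m M]M_sym -trmx_mul.
  rewrite -mulmxA -/w -/(frob w) => h; apply: le_trans h _.
  by rewrite le_eqVlt; apply/orP; left; apply/eqP; ring.
(* Dividing by q + 1 instead of q also covers q = 0. *)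
apply: frob_le0; have := ineq (- (frob w / (q + 1))).
have q1 : 0 < q + 1 by rewrite ltr_wpDl.
have -> : 2 * - (frob w / (q + 1)) * frob w + (- (frob w / (q + 1))) ^+ 2 * q =
    - (frob w / (q + 1)) ^+ 2 * (q + 2) by field; rewrite gt_eqF.
rewrite mulNr oppr_ge0 pmulr_lle0 ?ltr_wpDl// => h.
have /eqP : (frob w / (q + 1)) ^+ 2 = 0 by apply/eqP; rewrite eq_le h sqr_ge0.
by rewrite sqrf_eq0 mulf_eq0 invr_eq0 (gt_eqF q1) orbF => /eqP->.
Qed.

Lemma psd_neq0 : M != 0 -> exists v : 'cV_n, 0 < \tr (v^T *m M *m v).
Proof.
move=> M0; apply: contrapT => nex; case/eqP: M0; apply/matrixP => i j.
have Mj : M *m delta_mx j 0 = 0 :> 'cV_n.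
  apply: psd_null; apply/eqP; rewrite eq_le M_psd andbT leNgt.
  by apply/negP => h; apply: nex; exists (delta_mx j 0).
by have /matrixP/(_ i 0) := Mj; rewrite -colE !mxE.
Qed.

End QuadraticForm.

(** * Eigenvalues and spectral radius *)

Import ComplexField.Normc.
Local Notation toC A := (map_mx (real_complex _) A).

Section SpectralRadius.
Variable R : realType.

Lemma normc_ge0 (z : R[i]) : 0 <= normc z.
Proof. by case: z => a b; exact: sqrtr_ge0. Qed.

Lemma normcX (z : R[i]) k : normc (z ^+ k) = normc z ^+ k.
Proof. by elim: k => [|k IH]; rewrite ?normc1// !exprS normcM IH. Qed.

Lemma normc_real (a : R) : normc (real_complex R a) = `|a|.
Proof. by rewrite /= expr0n /= addr0 sqrtr_sqr. Qed.

Lemma normc_sum (I : Type) (r : seq I) (F : I -> R[i]) :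
  normc (\sum_(i <- r) F i) <= \sum_(i <- r) normc (F i).
Proof.
elim/big_rec2: _ => [|i y z _ le_zy]; first by rewrite normc0.
by apply: le_trans (le_normcD _ _) _; rewrite lerD2l.
Qed.

Lemma char_poly_split n (A : 'M[R]_n) : exists2 rs : seq R[i],
  size rs = n & char_poly (toC A) = \prod_(z <- rs) ('X - z%:P).
Proof.
have [rs] := closed_field_poly_normal (char_poly (toC A)).
rewrite (monicP (char_poly_monic _)) scale1r => E; exists rs => //.
by apply/succn_inj; rewrite -(size_char_poly (toC A)) E size_prod_XsubC.
Qed.

Lemma eigenvalue_split n (A : 'M[R]_n) (rs : seq R[i]) z :
  char_poly (toC A) = \prod_(z <- rs) ('X - z%:P) ->
  eigenvalue (toC A) z = (z \in rs).
Proof. by move=> E; rewrite eigenvalue_root_char E root_prod_XsubC. Qed.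

Lemma exists_eigenvalue n (A : 'M[R]_n) :
  (0 < n)%N -> exists z, eigenvalue (toC A) z.
Proof.
move=> n0; have [[|z rs] sz E] := char_poly_split A.
  by rewrite -sz in n0.
by exists z; rewrite (eigenvalue_split _ E) mem_head.
Qed.

Lemma eigenvalue_le_spectral_radius n (A : 'M[R]_n) z :
  eigenvalue (toC A) z -> normc z <= spectral_radius A.
Proof.
move=> Az; apply: ub_le_sup; last by exists z.
(* The sum of the moduli of all roots serves as an upper bound, so the supremum is meaningful. *)
have [rs _ E] := char_poly_split A; exists (\sum_(z <- rs) normc z).
move=> _ [t /= At <-]; have trs : t \in rs by rewrite -(eigenvalue_split _ E).
by rewrite (big_rem _ trs) /= lerDl sumr_ge0// => *; exact: normc_ge0.
Qed.

Lemma spectral_radius_le n (A : 'M[R]_n) c : (0 < n)%N ->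
  (forall z, eigenvalue (toC A) z -> normc z <= c) -> spectral_radius A <= c.
Proof.
move=> n0 Ac; apply: ge_sup.
  by have [z Az] := exists_eigenvalue A n0; exists (normc z); exists z.
by move=> _ [z /= Az <-]; exact: Ac.
Qed.

Lemma spectral_radius0 n : (0 < n)%N -> spectral_radius (0 : 'M[R]_n) = 0.
Proof.
move=> n0; have eig0 z : eigenvalue (toC (0 : 'M[R]_n)) z -> normc z = 0.
  move=> /eigenvalueP[v]; rewrite map_mx0 mulmx0 => /esym/eqP.
  by rewrite scaler_eq0 => /orP[/eqP->|->//]; rewrite normc0.
apply/eqP; rewrite eq_le spectral_radius_le//=; last by move=> z /eig0->.
have [z Az] := exists_eigenvalue (0 : 'M[R]_n) n0.
by rewrite -(eig0 _ Az); exact: eigenvalue_le_spectral_radius.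
Qed.

(** Squares of eigenvalues of A are eigenvalues of its square. For a constant radius r this reads r
    <= sqrt r. *)
Lemma spectral_radius_sqr n (A : 'M[R]_n) : (0 < n)%N ->
  spectral_radius A <= Num.sqrt (spectral_radius (A *m A)).
Proof.
move=> n0; apply: spectral_radius_le => // z /eigenvalueP[v vA v0].
rewrite -(ger0_norm (normc_ge0 z)) -sqrtr_sqr ler_sqrt; last first.
  have [t At] := exists_eigenvalue (A *m A) n0.
  exact: le_trans (normc_ge0 t) (eigenvalue_le_spectral_radius At).
rewrite -normcX; apply: eigenvalue_le_spectral_radius.
apply/eigenvalueP; exists v => //.
by rewrite map_mxM mulmxA vA -scalemxAl vA scalerA expr2.
Qed.

Lemma mxtrace_le n (A : 'M[R]_n) c : (0 < n)%N ->
  (forall z, eigenvalue (toC A) z -> normc z <= c) -> `|\tr A| <= c *+ n.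
Proof.
move=> n0 Ac; have [rs sz E] := char_poly_split A.
have trE : real_complex R (\tr A) = \sum_(z <- rs) z.
  apply: oppr_inj; rewrite -coefPn_prod_XsubC -?E ?sz ?lt0n_neq0//.
  by rewrite char_poly_trace// trace_map_mx.
rewrite -normc_real trE; apply: le_trans (normc_sum _ _) _.
rewrite -sz -iter_addr_0 -count_predT -big_const_seq big_seq [leRHS]big_seq.
by apply: ler_sum => z zrs; apply: Ac; rewrite (eigenvalue_split _ E).
Qed.

Lemma geometric_recurrence_near0 (a b : R^nat) (q : R) : 0 <= q -> q < 1 ->
  (forall k, 0 <= a k) -> (forall k, a k.+1 <= q * a k + b k) ->
  (forall e : R, 0 < e -> \forall k \near \oo, b k <= e) ->
  forall e : R, 0 < e -> \forall k \near \oo, a k <= e.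
Proof.
move=> q0 q1 a0 ab b0 e e0.
(* With this tolerance on [b], the value e / 2 is the fixed point of t |-> q t + e / 2 * (1 - q), so
   from some index on the excess over it decays geometrically. *)
have e'0 : 0 < e / 2 * (1 - q) by rewrite mulr_gt0 ?divr_gt0 ?subr_gt0.
have [N _ bN] := b0 _ e'0.
have aN j : a (N + j)%N <= q ^+ j * a N + e / 2.
  elim: j => [|j IH]; first by rewrite addn0 mul1r lerDl ltW ?divr_gt0.
  rewrite addnS; apply: le_trans (ab _) _.
  have := bN (N + j)%N (leq_addr _ _).
  have := ler_wpM2l q0 IH; rewrite exprS /=; lra.
have /cvgrPdist_le/(_ (e / (2 * (a N + 1)))) : (GRing.exp q : R^nat) @ \oo --> 0.
  by apply: cvg_expr; rewrite ger0_norm.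
have aN1 : 0 < a N + 1 by rewrite ltr_wpDl.
case; first by rewrite divr_gt0// mulr_gt0.
move=> M _ qM; exists (N + M)%N => // k /= NMk.
rewrite -(subnKC (leq_trans (leq_addr _ _) NMk)).
apply: le_trans (aN _) _.
have Mk : (M <= k - N)%N by rewrite leq_subRL// (leq_trans _ NMk)// leq_addr.
have := qM _ Mk; rewrite /= sub0r normrN ger0_norm ?exprn_ge0// => qk.
suff : q ^+ (k - N) * a N <= e / 2 by lra.
apply: (@le_trans _ _ (e / (2 * (a N + 1)) * (a N + 1))); last first.
  by rewrite invfM mulrA -mulrA mulVf ?mulr1// gt_eqF.
by apply: ler_pM; rewrite ?exprn_ge0// lerDl.
Qed.

(* Cayley-Hamilton peels off one factor A - z at a time, each giving a
   recurrence a_(k+1) = z a_k + o(1). *)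
Lemma small_eigenvalues_near0 n (A : 'M[R]_n.+1) (v : 'cV[R]_n.+1) :
  (forall z, eigenvalue (toC A) z -> normc z < 1) ->
  forall e : R, 0 < e -> \forall k \near \oo, forall i, `|(A ^+ k *m v) i 0| <= e.
Proof.
move=> A1 e e0; have [rs _ E] := char_poly_split A.
have rs1 z : z \in rs -> normc z < 1.
  by move=> zrs; apply: A1; rewrite (eigenvalue_split _ E).
have main (B : 'M[R[i]]_n.+1) (w : 'cV_n.+1) :
    horner_mx B (\prod_(z <- rs) ('X - z%:P)) *m w = 0 ->
    forall i (e : R), 0 < e -> \forall k \near \oo, normc ((B ^+ k *m w) i 0) <= e.
  elim: rs rs1 w {E} => [_ w|z rs IH rs1 w].
    rewrite big_nil rmorph1 mul1mx => -> i e' e'0; near=> k.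
    by rewrite mulmx0 mxE normc0 ltW.
  (* The remaining factors annihilate (B - z) w, so by induction B^(k+1) w - z B^k w tends to 0. *)
  rewrite big_cons mulrC rmorphM /= -mulmxA.
  rewrite rmorphB /= horner_mx_X horner_mx_C => Bw i.
  have rs1' t : t \in rs -> normc t < 1.
    by move=> trs; apply: rs1; rewrite in_cons trs orbT.
  have {Bw}IHw := IH rs1' _ Bw i.
  apply: geometric_recurrence_near0 IHw; first exact: normc_ge0.
  - exact: rs1 (mem_head _ _).
  - by move=> k; exact: normc_ge0.
  - move=> k; rewrite -normcM; apply: le_trans (le_normcD _ _).
    rewrite mulmxBl mul_scalar_mx mulmxBr mulmxA mulmxE -exprSr -scalemxAr.
    by rewrite !mxE subrKC.
have : horner_mx (toC A) (\prod_(z <- rs) ('X - z%:P)) *m toC v = 0.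
  by rewrite -E Cayley_Hamilton mul0mx.
move=> /main{}main; apply: filter_forall => i.
have := main i e e0; apply: filterS => k.
by rewrite -[toC A ^+ k](rmorphXn (map_mx (real_complex R))) -map_mxM mxE normc_real.
Unshelve. all: by end_near. Qed.

Lemma bounded_geometric_le1 (q c C : R) : 0 <= q -> 0 < c ->
  (forall k, q ^+ k * c <= C) -> q <= 1.
Proof.
move=> q0 c0 qC; rewrite leNgt; apply/negP => q1.
have q'0 : 0 < q by exact: lt_trans q1.
have C0 : 0 < C by apply: lt_le_trans (qC 0%N); rewrite mul1r.
have /cvgrPdist_lt/(_ (c / C)) : (GRing.exp q^-1 : R^nat) @ \oo --> 0.
  by apply: cvg_expr; rewrite ger0_norm ?invr_ge0// invf_lt1.
case; first exact: divr_gt0.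
move=> N _ /(_ N (leqnn _)) /=; rewrite sub0r normrN ger0_norm ?exprn_ge0 ?invr_ge0//.
rewrite exprVn ltr_pdivlMr// mulrC ltr_pdivrMr ?exprn_gt0// mulrC.
by rewrite ltNge qC.
Qed.

End SpectralRadius.

(** * Irreducible semigroups *)

(** Take a subspace inside [P] of maximal dimension: adding the line of a vector of [P] cannot
    enlarge it. This feeds linear conditions to [irreducible_family], which quantifies over
    [vspace]. *)
Lemma vspace_of_pred (F : fieldType) (vT : vectType F) (P : vT -> Prop) :
  P 0 -> (forall a u v, P u -> P v -> P (a *: u + v)) ->
  exists U : {vspace vT}, forall v, v \in U <-> P v.
Proof.
move=> P0 Plin.
pose D (r : nat) := `[< exists2 U : {vspace vT}, \dim U = r & forall v, v \in U -> P v >].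
have exD : exists r, D r.
  exists 0%N; apply/asboolP; exists 0%VS; first exact: dimv0.
  by move=> v; rewrite memv0 => /eqP->.
have ubD r : D r -> (r <= \dim {:vT})%N.
  by move=> /asboolP[U <- _]; rewrite dimvS// subvf.
have [_ /asboolP[U <- UP] maxU] := ex_maxnP exD ubD.
exists U => v; split=> [|Pv]; first exact: UP.
have : (\dim (U + <[v]>) <= \dim U)%N.
  apply: maxU; apply/asboolP; exists (U + <[v]>)%VS => // w.
  case/memv_addP => u uU [_ /vlineP[a ->] ->].
  by rewrite addrC; apply: Plin => //; exact: UP.
rewrite (geq_leqif (dimv_leqif_sup (addvSl U <[v]>))) => /subvP; apply.
by rewrite (subvP (addvSr _ _))// memv_line.
Qed.

Lemma free_spanning_subset (F : fieldType) (vT : vectType F) (S : set vT) :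
  exists Bs : seq vT, [/\ free Bs, forall B, B \in Bs -> S B &
    forall A, S A -> A \in <<Bs>>%VS].
Proof.
pose D r := `[< exists Bs : seq vT,
  [/\ free Bs, forall B, B \in Bs -> S B & size Bs = r] >].
have exD : exists r, D r.
  by exists 0%N; apply/asboolP; exists [::]; split=> //; exact: nil_free.
have ubD r : D r -> (r <= \dim {:vT})%N.
  by move=> /asboolP[Bs [/eqP<- _ <-]]; rewrite dimvS// subvf.
have [_ /asboolP[Bs [fB SB <-]] maxB] := ex_maxnP exD ubD.
exists Bs; split=> // A SA; apply: contraT => AB.
suff : D (size (A :: Bs)) by move=> /maxB; rewrite /= ltnn.
apply/asboolP; exists (A :: Bs); split=> //; first by rewrite free_cons AB.
by move=> B; rewrite in_cons => /orP[/eqP->|/SB].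
Qed.

(** In the rank factorisation E = C R, idempotency gives R C = 1, and the trace of C R is that of R
    C. *)
Lemma mxtrace_idempotent (F : fieldType) n (E : 'M[F]_n) :
  E *m E = E -> \tr E = (\rank E)%:R.
Proof.
move=> idE; have CR := mulmx_base E.
have RC : row_base E *m col_base E = 1%:M.
  apply: (row_free_inj (row_base_free E)); apply: (row_full_inj (col_base_full E)).
  by rewrite /= mul1mx -mulmxA CR mulmxA CR idE.
by rewrite -{1}CR mxtrace_mulC RC mxtrace1.
Qed.

Lemma horner_mx_fixed (F : fieldType) n (N : 'M[F]_n.+1) (v : 'cV_n.+1) p :
  N *m v = v -> horner_mx N p *m v = p.[1] *: v.
Proof.
move=> Nv; elim/poly_ind: p => [|p c IH]; first by rewrite rmorph0 horner0 mul0mx scale0r.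
rewrite rmorphD rmorphM /= horner_mx_X horner_mx_C mulmxDl -mulmxA Nv IH.
by rewrite hornerMXaddC mulr1 mul_scalar_mx scalerDl.
Qed.

(* In characteristic 0 some polynomial in N without constant term is a nonzero
   idempotent, whose trace is its rank. *)
Lemma fixed_vector_trace_neq0 (F : numFieldType) n (N : 'M[F]_n.+1)
    (v : 'cV_n.+1) : N *m v = v -> v != 0 ->
  exists q, \tr (N *m horner_mx N q) != 0.
Proof.
move=> Nv v0; set p := char_poly N.
have p0 : p != 0 by exact: monic_neq0 (char_poly_monic _).
have [m [h]] := multiplicity_XsubC p 0; rewrite p0 subr0 /= => h0 ph.
(* The exponent m + 1, not m, makes [e] divisible by X even if 0 is not an eigenvalue. As e is 1
   modulo h and 0 modulo X^m, it is idempotent modulo p. *)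
have /Bezout_eq1_coprimepP[[u w] /= uw] : coprimep h ('X ^+ m.+1).
  by apply: coprimep_expr; rewrite coprimepX.
exists (w * 'X^m).
set e := w * 'X^(m.+1) in uw *.
have -> : N *m horner_mx N (w * 'X^m) = horner_mx N e.
  by rewrite -{1}[N]horner_mx_X mulmxE -rmorphM /e exprSr mulrA mulrC.
(* By Cayley-Hamilton 0 = p(N) v = p(1) v, so h(1) = 0; then e(1) = 1 and e(N) fixes v, hence is
   nonzero. *)
have h1 : h.[1] = 0.
  have := horner_mx_fixed p Nv; rewrite Cayley_Hamilton mul0mx => /esym/eqP.
  rewrite scaler_eq0 (negPf v0) orbF ph hornerM hornerXn expr1n mulr1.
  by move/eqP.
have e1 : e.[1] = 1.
  by have := congr1 (horner^~ 1) uw; rewrite hornerD hornerM h1 mulr0 add0r hornerC.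
have idE : horner_mx N e *m horner_mx N e = horner_mx N e.
  apply/eqP; rewrite mulmxE -rmorphM -subr_eq0 -rmorphB /=.
  have -> : e * e - e = - (u * w * 'X) * p.
    by rewrite -[X in _ - X]mulr1 -uw /e ph exprSr; ring.
  by rewrite rmorphM /= Cayley_Hamilton mulr0.
rewrite mxtrace_idempotent// pnatr_eq0 mxrank_eq0.
apply: contra_neq v0 => E0.
by rewrite -[v]scale1r -e1 -(horner_mx_fixed _ Nv) E0 mul0mx.
Qed.

Section Irreducible.
Variables (R : realType) (n : nat) (S : set 'M[R]_n).
Hypotheses (S_semigroup : matrix_semigroup S).
Hypotheses (S_irreducible : irreducible_family S).

Lemma irreducible_pred (P : 'cV[R]_n -> Prop) :
  P 0 -> (forall a u v, P u -> P v -> P (a *: u + v)) ->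
  (forall A v, S A -> P v -> P (A *m v)) ->
  (forall v, P v -> v = 0) \/ (forall v, P v).
Proof.
move=> P0 Plin SP; have [U UP] := vspace_of_pred P0 Plin.
have [||] := S_irreducible (U := U).
- by move=> A v SA /UP Pv; apply/UP; exact: SP.
- by move=> U0; left=> v /UP; rewrite U0 memv0 => /eqP.
- by move=> UT; right=> v; apply/UP; rewrite UT memvf.
Qed.

(** The common kernel of S is invariant, and it is not the whole space because S has a nonzero
    element. *)
Lemma irreducible_common_kernel (w : 'cV[R]_n) :
  (exists2 A, S A & A != 0) -> (forall B, S B -> B *m w = 0) -> w = 0.
Proof.
move=> [A SA A0] Sw.
have [|||kS|kS] := @irreducible_pred (fun w => forall B, S B -> B *m w = 0).
- by move=> B _; rewrite mulmx0.
- by move=> a u v Su Sv B SB; rewrite mulmxDr -scalemxAr Su// Sv// scaler0 addr0.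
- by move=> C v SC Sv B SB; rewrite mulmxA Sv//; exact: S_semigroup.
- exact: kS.
- case/eqP: A0; apply/matrixP => i j; rewrite mxE.
  have /matrixP/(_ i 0) := kS (delta_mx j 0) _ SA.
  by rewrite -colE !mxE.
Qed.

(* The double annihilator of the orbit of x is an invariant subspace. *)
Lemma irreducible_orbit_total (x : 'cV[R]_n) (u : 'rV[R]_n) :
  (exists2 B, S B & B *m x != 0) ->
  (forall B, S B -> u *m B *m x = 0) -> u = 0.
Proof.
move=> [B SB Bx] ux.
pose P (v : 'cV[R]_n) := forall u : 'rV_n,
  (forall B, S B -> u *m B *m x = 0) -> u *m v = 0.
have [|||PS|PS] := @irreducible_pred P.
- by move=> ? _; rewrite mulmx0.
- by move=> a v w Pv Pw t tx; rewrite mulmxDr -scalemxAr Pv// Pw// scaler0 addr0.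
- move=> A v SA Pv t tx; rewrite mulmxA; apply: Pv => C SC.
  by rewrite -[t *m A *m C]mulmxA tx//; exact: S_semigroup.
- case/eqP: Bx; apply: PS => t tx; rewrite mulmxA; exact: tx.
- apply/rowP => j; have /matrixP/(_ 0 0) := PS (delta_mx j 0) _ ux.
  by rewrite -colE !mxE.
Qed.

End Irreducible.

(** * The trace form on the span of an irreducible semigroup *)

Section Bounded.
Variables (R : realType) (n : nat) (S : set 'M[R]_n.+1) (Bs : seq 'M[R]_n.+1).
Hypotheses (S_semigroup : matrix_semigroup S).
Hypotheses (S_irreducible : irreducible_family S).
Hypotheses (S_neq0 : exists2 A, S A & A != 0).
Hypotheses (SB : forall B, B \in Bs -> S B).
Hypotheses (spanS : forall A, S A -> A \in <<Bs>>%VS).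

Lemma span_ind (P : 'M[R]_n.+1 -> Prop) : P 0 ->
  (forall a A C, A \in Bs -> P C -> P (a *: A + C)) -> forall A, A \in <<Bs>>%VS -> P A.
Proof.
move=> P0 Plin A /(@coord_span _ _ _ (in_tuple Bs)) ->.
by apply: big_rec => // i C _ PC; apply: Plin => //; exact: mem_nth.
Qed.

Lemma span_mul A C : A \in <<Bs>>%VS -> C \in <<Bs>>%VS -> A *m C \in <<Bs>>%VS.
Proof.
have left_mul D : S D -> forall C, C \in <<Bs>>%VS -> D *m C \in <<Bs>>%VS.
  move=> SD; apply: span_ind => [|b B E /SB SB' IH]; first by rewrite mulmx0 mem0v.
  by rewrite mulmxDr -scalemxAr memvD// memvZ// spanS//; exact: S_semigroup.
move=> AB CB; move: A AB; apply: span_ind => [|a A D /SB SA IH].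
  by rewrite mul0mx mem0v.
by rewrite mulmxDl -scalemxAl memvD// memvZ// left_mul.
Qed.

Lemma span_trace_eq0 A :
  (forall B, B \in Bs -> \tr (A *m B) = 0) ->
  forall C, C \in <<Bs>>%VS -> \tr (A *m C) = 0.
Proof.
move=> AB C /(@coord_span _ _ _ (in_tuple Bs)) ->.
rewrite mulmx_sumr raddf_sum big1// => i _.
rewrite -scalemxAr /=.
by rewrite mxtraceZ AB ?mulr0// mem_nth.
Qed.

(** If w = A v is nonzero, irreducibility gives N' in the span with N' w = v. Then N = N' A fixes v,
    so some tr (N q(N)) is nonzero; but it equals tr (A q(N) N'), a value of the trace form at A. *)
Lemma trace_form_nondegenerate A : A \in <<Bs>>%VS ->
  (forall B, B \in Bs -> \tr (A *m B) = 0) -> A = 0.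
Proof.
move=> AB /span_trace_eq0 trA; apply: contrapT => /eqP A0.
have [j w0] : exists j, A *m delta_mx j 0 != 0 :> 'cV_n.+1.
  apply: contrapT => nex; case/eqP: A0; apply/matrixP => i j.
  have /negP := (forallNP _).2 nex j; rewrite negbK => /eqP/matrixP/(_ i 0).
  by rewrite -colE !mxE.
set v : 'cV_n.+1 := delta_mx j 0 in w0; set w := A *m v in w0.
have v0 : v != 0 by apply: contra_neq w0; rewrite /w => ->; rewrite mulmx0.
have [|||Pw|Pw] := @irreducible_pred _ _ S S_irreducible
    (fun z => exists2 N, N \in <<Bs>>%VS & z = N *m w).
- by exists 0; rewrite ?mem0v ?mul0mx.
- move=> a _ _ [M MB ->] [N NB ->]; exists (a *: M + N).
    by rewrite memvD// memvZ.
  by rewrite mulmxDl -scalemxAl.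
- move=> C _ SC [N NB ->]; exists (C *m N); last by rewrite mulmxA.
  by apply: span_mul => //; exact: spanS.
- case/eqP: w0; apply: (irreducible_common_kernel S_semigroup S_irreducible) => //.
  by move=> B SB'; apply: Pw; exists B => //; exact: spanS.
have [N' N'B vE] := Pw v.
pose N := N' *m A.
have NB : N \in <<Bs>>%VS by exact: span_mul.
have [q] : exists q, \tr (N *m horner_mx N q) != 0.
  by apply: (@fixed_vector_trace_neq0 _ _ _ v) => //; rewrite /N -mulmxA -vE.
have qB M : M \in <<Bs>>%VS -> horner_mx N q *m M \in <<Bs>>%VS.
  elim/poly_ind: q M => [|q c IH] M MB; first by rewrite rmorph0 mul0mx mem0v.
  rewrite rmorphD rmorphM /= horner_mx_X horner_mx_C mulmxDl mul_scalar_mx.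
  by rewrite memvD ?memvZ// -mulmxA IH// span_mul.
by rewrite /N -mulmxA mxtrace_mulC -mulmxA trA ?eqxx// qB.
Qed.

(** The coordinates of A in [Bs] come from the traces of A B_j by inverting the Gram matrix of the
    trace form; these traces are bounded since A B_j lies in S. *)
Lemma irreducible_trace_bounded (c : R) : free Bs ->
  (forall A, S A -> `|\tr A| <= c) ->
  exists C, forall A, S A -> forall i j, `|A i j| <= C.
Proof.
move=> fB trS; set k := size Bs.
pose Gram := \matrix_(i < k, j < k) \tr (Bs`_i *m Bs`_j).
pose vecs := \matrix_(i < k) mxvec Bs`_i.
have SBi (i : 'I_k) : S Bs`_i by apply: SB; exact: mem_nth.
have combE (a : 'rV_k) : vec_mx (a *m vecs) = \sum_i a 0 i *: Bs`_i.
  rewrite mulmx_sum_row linear_sum; apply: eq_bigr => i _.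
  by rewrite linearZ /= rowK mxvecK.
have combB (a : 'rV_k) : vec_mx (a *m vecs) \in <<Bs>>%VS.
  by rewrite combE; apply: memv_suml => i _; rewrite memvZ// spanS.
have trGram (a : 'rV_k) (j : 'I_k) :
    \tr (vec_mx (a *m vecs) *m Bs`_j) = (a *m Gram) 0 j.
  rewrite combE mulmx_suml raddf_sum mxE; apply: eq_bigr => i _.
  by rewrite /= -scalemxAl mxtraceZ !mxE.
have GramU : Gram \in unitmx.
  rewrite -row_free_unit -kermx_eq0; apply/rowV0P => a /sub_kermxP aG.
  have a0 : vec_mx (a *m vecs) = 0.
    apply: trace_form_nondegenerate => // B /(nthP 0)[j jk <-].
    by rewrite (trGram a (Ordinal jk)) aG mxE.
  apply/rowP => i; rewrite mxE; move: a0; rewrite combE => a0.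
  exact: (freeP (X := in_tuple Bs) fB (fun i => a 0 i) a0).
pose K := k%:R * c ^+ 2 * frob (invmx Gram) * frob vecs.
exists (K + 1) => A SA i j.
have [a Aa] : exists a : 'rV_k, A = vec_mx (a *m vecs).
  exists (\row_i coord (in_tuple Bs) i A).
  rewrite combE {1}(coord_span (X := in_tuple Bs) (spanS SA)).
  by apply: eq_bigr => l _; rewrite mxE.
have tr_c l : (a *m Gram) 0 l ^+ 2 <= c ^+ 2.
  have trAl : `|(a *m Gram) 0 l| <= c by rewrite -trGram -Aa; apply/trS/S_semigroup.
  by rewrite -real_normK ?num_real// ler_pXn2r ?nnegrE// (le_trans _ trAl).
apply: normr_le_sqrD1; rewrite Aa mxE.
apply: le_trans (frob_ge_entry _ _ _) _; apply: le_trans (frobM _ _) _.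
apply: ler_wpM2r; first exact: frob_ge0.
rewrite -[a](mulmxK GramU); apply: le_trans (frobM _ _) _.
apply: ler_wpM2r; first exact: frob_ge0.
rewrite frobE mulr_natl -[X in _ *+ X]card_ord -sumr_const.
by apply: ler_sum => l _; rewrite big_ord1.
Qed.

End Bounded.

(** * Invariant norms *)

Lemma euclidean_norm_eq1 (R : realType) n (x : 'cV[R]_n) :
  euclidean_norm x = 1 <-> frob x = 1.
Proof.
have -> : euclidean_norm x = Num.sqrt (frob x).
  by rewrite frobE big_ord1.
split=> [x1|->]; last exact: sqrtr1.
by rewrite -[frob x]sqr_sqrtr ?frob_ge0// x1 expr1n.
Qed.

Lemma mxtrace_form_mul (R : realType) n p q (M : 'M[R]_n) (B : 'M[R]_(n, p))
    (X : 'M[R]_(p, q)) :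
  (B *m X)^T *m M *m (B *m X) = X^T *m (B^T *m M *m B) *m X.
Proof. by rewrite trmx_mul !mulmxA. Qed.

(** * From constant spectral radius to an invariant norm, and back *)

Section Main.
Variables (R : realType) (n : nat) (S : set 'M[R]_n.+1).
Hypotheses (S_closed : closed S).
Hypotheses (S_semigroup : matrix_semigroup S).
Hypotheses (S_irreducible : irreducible_family S).

Lemma constant_spectral_radius_compact (A0 : 'M[R]_n.+1) : S A0 ->
  constant_spectral_radius S -> compact S /\ ~ S 0.
Proof.
move=> SA0 [r r0 Sr].
have notS0 : ~ S 0.
  by move=> /Sr; rewrite spectral_radius0// => E; move: r0; rewrite -E eqxx.
split=> //.
have r_ge0 : 0 <= r.
  rewrite -(Sr _ SA0); have [z Az] := exists_eigenvalue A0 (ltn0Sn n).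
  exact: le_trans (normc_ge0 z) (eigenvalue_le_spectral_radius Az).
(* [A0] and its square have the same radius r, so r <= sqrt r. *)
have r_le1 : r <= 1.
  have := spectral_radius_sqr A0 (ltn0Sn n).
  rewrite !Sr//; last exact: S_semigroup.
  rewrite -(@ler_pXn2r _ 2)// ?nnegrE ?sqrtr_ge0// sqr_sqrtr//.
  by rewrite expr2 ger_pMr// lt_neqAle eq_sym r0.
have [Bs [fB SB spanS]] := free_spanning_subset S.
have S_neq0 : exists2 A, S A & A != 0.
  by exists A0 => //; apply/eqP => A00; apply: notS0; rewrite -A00.
have [|C SC] := @irreducible_trace_bounded R n S Bs S_semigroup S_irreducible
  S_neq0 SB spanS (1 *+ n.+1) fB.
- move=> A SA; apply: mxtrace_le => // z Az.
  by apply: le_trans r_le1; rewrite -(Sr _ SA); exact: eigenvalue_le_spectral_radius.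
exact: compact_mx S_closed SC.
Qed.

(* M comes from the compact group E S E at an idempotent E of minimal rank, and x
   lies in the range of E. *)
Lemma compact_semigroup_form : compact S -> ~ S 0 -> S !=set0 ->
  exists (M : 'M[R]_n.+1) (x : 'cV_n.+1),
    [/\ M^T = M, forall v : 'cV_n.+1, 0 <= \tr (v^T *m M *m v), M != 0,
        \tr (x^T *m M *m x) = 1 &
        forall A, S A -> \tr ((A *m x)^T *m M *m (A *m x)) = 1].
Proof.
move=> cS nS0 S0.
have [E [SE idE invE]] := minimal_rank_idempotent cS S0 S_semigroup.
pose G := [set E *m A *m E | A in S].
have GE : G E by exists E; rewrite ?idE.
have [C SC] := compact_mx_bounded cS.
have [||||||M [Msym Mpsd M0 MG]] := @bounded_group_invariant_form _ _ G E
    (\sum_(j < n.+1) \sum_(i < n.+1) C ^+ 2).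
- by apply/eqP => E0; apply: nS0; rewrite -E0.
- exact: GE.
- move=> _ _ [A SA <-] [B SB <-]; exists (A *m E *m E *m B).
    exact: (S_semigroup (S_semigroup (S_semigroup SA SE) SE) SB).
  by rewrite !mulmxA.
- by move=> _ [A SA <-]; split; [rewrite !mulmxA idE|rewrite -!mulmxA idE].
- move=> _ [A SA <-]; have [B [SB ABE]] := invE _ SA.
  by exists (E *m B *m E) => //; exists B.
- move=> _ [A SA <-]; rewrite frobE.
  apply: ler_sum => j _; apply: ler_sum => i _.
  have EAE : S (E *m A *m E) := S_semigroup (S_semigroup SE SA) SE.
  have := SC _ EAE i j => h.
  rewrite -real_normK ?num_real// ler_pXn2r ?nnegrE//.
  exact: le_trans h.
have [v qv] := psd_neq0 Msym Mpsd M0.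
have EM : E^T *m M *m E = M by exact: MG.
(* As E^T M E = M, the form takes the same value at [E *m v] as at v; the scalar normalises it to
   1. *)
set a := \tr _ in qv; pose x := (Num.sqrt a)^-1 *: (E *m v).
have Ex : E *m x = x by rewrite /x -scalemxAr mulmxA idE.
have qx : \tr (x^T *m M *m x) = 1.
  rewrite /x; have -> : ((Num.sqrt a)^-1 *: (E *m v))^T = (Num.sqrt a)^-1 *: (E *m v)^T.
    by rewrite linearZ.
  rewrite -scalemxAl -scalemxAr -scalemxAl scalerA mxtraceZ mxtrace_form_mul EM -/a.
  by rewrite -invfM -expr2 sqr_sqrtr ?ltW// mulVf// gt_eqF.
exists M, x; split=> // A SA.
(* [M] absorbs one factor E and x the other, which turns A into an element of the group. *)
rewrite -EM -mxtrace_form_mul; have -> : E *m (A *m x) = E *m A *m E *m x.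
  by rewrite -!mulmxA Ex.
by rewrite mxtrace_form_mul MG//; exists A.
Qed.

Lemma constant_spectral_radius_invariant_norm (A0 : 'M[R]_n.+1) : S A0 ->
  constant_spectral_radius S ->
  exists (T : 'M[R]_n.+1) (x : 'cV[R]_n.+1), [/\ T \in unitmx, euclidean_norm x = 1 &
    forall A : 'M[R]_n.+1, S A -> euclidean_norm (invmx T *m A *m T *m x) = 1].
Proof.
move=> SA0 csr; have [cS nS0] := constant_spectral_radius_compact SA0 csr.
have [|M [x [Msym Mpsd M0 qx qSx]]] := compact_semigroup_form cS nS0.
  by exists A0.
have [Bs [_ SB spanS]] := free_spanning_subset S.
(* Counts [M] together with its transforms by [Bs]: [Q] averages forms that all equal 1 at x and on
   its orbit. *)
pose N : R := (size Bs).+1%:R.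
pose Q := N^-1 *: (M + \sum_(B <- Bs) B^T *m M *m B).
have N0 : 0 < N by rewrite ltr0n.
have QE (v : 'cV_n.+1) : \tr (v^T *m Q *m v) = N^-1 *
    (\tr (v^T *m M *m v) + \sum_(B <- Bs) \tr ((B *m v)^T *m M *m (B *m v))).
  rewrite /Q -scalemxAr -scalemxAl mxtraceZ mulmxDr mulmxDl mxtraceD.
  rewrite mulmx_sumr mulmx_suml raddf_sum /=; congr (_ * (_ + _)).
  by apply: eq_bigr => B _; rewrite mxtrace_form_mul.
have [||L LU QL] := @cholesky _ _ Q.
- rewrite /Q linearZ linearD /= Msym linear_sum /=; congr (_ *: (_ + _)).
  by apply: eq_bigr => B _; rewrite !trmx_mul trmxK Msym mulmxA.
- move=> v v0.
  have sum0 : 0 <= \sum_(B <- Bs) \tr ((B *m v)^T *m M *m (B *m v)).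
    by apply: sumr_ge0 => B _.
  rewrite QE mulr_gt0 ?invr_gt0// lt_neqAle addr_ge0// andbT.
  apply: contra_neq v0 => /esym/eqP; rewrite paddr_eq0// => /andP[/eqP qv].
  rewrite psumr_eq0 => [/allP qB|B _ //].
  (* An invariant subspace containing the null vectors of [Q]: for these, vanishing on [Bs] extends
     to S by linearity. It is proper as [M] is nonzero. *)
  pose P (w : 'cV[R]_n.+1) := M *m w = 0 /\ forall B, S B -> M *m (B *m w) = 0.
  have [|||PS|PS] := @irreducible_pred _ _ S S_irreducible P.
  + by split=> [|B _]; rewrite ?mulmx0.
  + move=> b u w [Mu MSu] [Mw MSw]; split=> [|B SB'].
      by rewrite mulmxDr -scalemxAr Mu Mw scaler0 addr0.
    by rewrite !mulmxDr -!scalemxAr MSu// MSw// scaler0 addr0.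
  + move=> B w SB' [_ MSw]; split=> [|C SC]; first exact: MSw.
    by rewrite (mulmxA C); apply: MSw; exact: S_semigroup.
  + apply: PS; split; first exact: psd_null qv.
    move=> B /spanS; move: B; apply: span_ind => [|b B C BBs MC].
      by rewrite mul0mx mulmx0.
    rewrite mulmxDl mulmxDr MC addr0 -scalemxAl -scalemxAr (psd_null Msym) ?scaler0//.
    exact/eqP/qB.
  + case/eqP: M0; apply/matrixP => i j; rewrite mxE.
    have [/matrixP/(_ i 0) + _] := PS (delta_mx j 0).
    by rewrite -colE !mxE.
have LUK : invmx (invmx L) = L by exact: invmxK.
have Lx (y : 'cV_n.+1) : frob (L *m y) = \tr (y^T *m Q *m y).
  by rewrite /frob QL trmx_mul !mulmxA.
have sum1 (F : 'M[R]_n.+1 -> R) : (forall B, S B -> F B = 1) ->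
    N^-1 * (1 + \sum_(B <- Bs) F B) = 1.
  move=> F1; have -> : \sum_(B <- Bs) F B = (size Bs)%:R.
    rewrite big_seq (eq_bigr (fun=> 1)) => [|B /SB]; last exact: F1.
    by rewrite -big_seq -sum1_size natr_sum.
  by rewrite nat1r mulVf// gt_eqF.
(* In the coordinates L y the form [Q] is the squared Euclidean norm. *)
exists (invmx L), (L *m x); split; first by rewrite unitmx_inv.
  by apply/euclidean_norm_eq1; rewrite Lx QE qx sum1.
move=> A SA; apply/euclidean_norm_eq1.
rewrite LUK mulmxA mulmxKV// -mulmxA Lx QE qSx// sum1// => B SB'.
by rewrite (mulmxA B); apply: qSx; exact: S_semigroup.
Qed.

(** * The converse: an invariant norm forces spectral radius 1 *)

Section InvariantNorm.
Variables (T : 'M[R]_n.+1) (x : 'cV[R]_n.+1).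
Hypotheses (T_unit : T \in unitmx).
Hypotheses (Sx1 : forall A, S A -> euclidean_norm (invmx T *m A *m T *m x) = 1).

Let S_power A k : S A -> S (A ^+ k.+1).
Proof.
by move=> SA; elim: k => [//|k IH]; rewrite exprS; exact: S_semigroup.
Qed.

Let frobSx A : S A -> frob (invmx T *m (A *m (T *m x))) = 1.
Proof. by move=> /Sx1/euclidean_norm_eq1; rewrite !mulmxA. Qed.

(** Otherwise the vectors A^k T x would tend to 0, although their images under the inverse of T keep
    norm 1. *)
Lemma invariant_norm_large_eigenvalue A : S A ->
  exists2 z, eigenvalue (toC A) z & 1 <= normc z.
Proof.
move=> SA; apply: contrapT => nex.
have small z : eigenvalue (toC A) z -> normc z < 1.
  by move=> Az; rewrite ltNge; apply/negP => z1; apply: nex; exists z.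
set c := frob (invmx T).
have c0 : 0 <= c by exact: frob_ge0.
(* Entries at most e <= 1 have squares at most e, so the squared norm is at most c e (n + 1) = c /
   (2 (c + 1)) < 1. *)
pose e := (2 * (c + 1) * n.+1%:R)^-1.
have e0 : 0 < e by rewrite invr_gt0 !mulr_gt0// ltr_wpDl.
have e1 : e <= 1.
  rewrite invf_le1 ?mulr_gt0 ?ltr_wpDl//.
  have : 1 <= n.+1%:R :> R by rewrite ler1n.
  nra.
(* A positive exponent is taken because S may lack the identity. *)
have [N _ /(_ N.+1 (leqnSn _)) /= Nsmall] :=
  small_eigenvalues_near0 (T *m x) small e0.
have := frobSx (S_power N SA); apply/eqP; rewrite lt_eqF//.
apply: le_lt_trans (frobM _ _) _.
apply: (@le_lt_trans _ _ (c * (e *+ n.+1))).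
  rewrite ler_wpM2l// frobE big_ord1 -[X in _ *+ X]card_ord -sumr_const.
  apply: ler_sum => i _; rewrite -real_normK ?num_real//.
  have := Nsmall i; have := normr_ge0 ((A ^+ N.+1 *m (T *m x)) i 0); nra.
rewrite -mulr_natr /e invfM -mulrA mulVf ?pnatr_eq0// mulr1.
by rewrite ltr_pdivrMr ?mulr_gt0 ?ltr_wpDl//; lra.
Qed.

(** For a left eigenvector u and y = B T x with u y nonzero, z^k u y = u A^k y stays bounded because
    A^k B is in S. *)
Lemma invariant_norm_eigenvalue_le1 A z : S A ->
  eigenvalue (toC A) z -> normc z <= 1.
Proof.
move=> SA /eigenvalueP[u uA u0].
have [B SB uB] : exists2 B, S B & u *m toC (B *m (T *m x)) != 0.
  apply: contrapT => nex; case/eqP: u0.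
  have uB B : S B -> u *m toC (B *m (T *m x)) = 0.
    by move=> SB; apply/eqP/negPn/negP => uB0; apply: nex; exists B.
  (* Used with f the real and the imaginary part: each is a real row annihilating the orbit of T x,
     hence zero. *)
  have real_part (f : R[i] -> R) : f 0 = 0 -> {morph f : a b / a + b} ->
      (forall a b, f (a * real_complex R b) = f a * b) -> map_mx f u = 0.
    move=> f0 fD fM.
    apply: (@irreducible_orbit_total _ _ S S_semigroup S_irreducible (T *m x)).
      exists A => //; apply/eqP => ATx; have := frobSx SA.
      by rewrite ATx mulmx0 /frob mulmx0 mxtrace0 => /esym/eqP; rewrite oner_eq0.
    move=> B /uB/matrixP uB0; apply/matrixP => i j; have := uB0 i j.
    rewrite -mulmxA !mxE => /(congr1 f); rewrite f0 (big_morph f fD f0) => fu0.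
    rewrite -[RHS]fu0.
    by apply: eq_bigr => k _; rewrite !mxE fM.
  have Reu : map_mx (@complex.Re R) u = 0.
    by apply: real_part => [//|[a b] [a' b'] //|[a b] c /=]; rewrite mulr0 subr0.
  have Imu : map_mx (@complex.Im R) u = 0.
    by apply: real_part => [//|[a b] [a' b'] //|[a b] c /=]; rewrite mulr0 add0r.
  apply/rowP => j; move/rowP/(_ j): Reu; move/rowP/(_ j): Imu; rewrite !mxE.
  by case: (u 0 j) => a b /= -> ->.
have uAk k : u *m toC A ^+ k = z ^+ k *: u.
  elim: k => [|k IH]; first by rewrite mulmx1 scale1r.
  by rewrite exprS -mulmxE mulmxA uA -scalemxAl IH scalerA -exprS.
have [y yE] : exists y, y = B *m (T *m x) by exists (B *m (T *m x)).
rewrite -yE in uB.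
pose c := normc ((u *m toC y) 0 0).
have c0 : 0 < c.
  rewrite lt_neqAle normc_ge0 andbT eq_sym; apply: contra_neq uB => /eq0_normc u00.
  by apply/matrixP => i j; rewrite !ord1 u00 mxE.
apply: (@bounded_geometric_le1 _ _ c (\sum_j normc (u 0 j) * (frob T + 1)) _ c0).
  exact: normc_ge0.
move=> k; rewrite -normcX -normcM.
have -> : z ^+ k * (u *m toC y) 0 0 = (u *m toC (A ^+ k *m y)) 0 0.
  rewrite map_mxM mulmxA (rmorphXn (map_mx (real_complex R))) uAk.
  by rewrite -scalemxAl [RHS]mxE.
rewrite mxE; apply: le_trans (normc_sum _ _) _; apply: ler_sum => j _.
rewrite normcM ler_wpM2l ?normc_ge0// mxE normc_real.
apply: normr_le_sqrD1; apply: le_trans (frob_ge_entry _ _ _) _.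
have -> : A ^+ k *m y = T *m (invmx T *m (A ^+ k *m B *m (T *m x))).
  by rewrite mulKVmx// yE !mulmxA.
apply: le_trans (frobM _ _) _; rewrite frobSx ?mulr1//.
(* For k = 0 the product is [B] itself; starting from B T x rather than T x avoids the identity. *)
by case: k => [|k]; [rewrite mul1mx|apply: S_semigroup => //; exact: S_power].
Qed.

Lemma invariant_norm_constant_spectral_radius : constant_spectral_radius S.
Proof.
exists 1; first exact: oner_neq0.
move=> A SA; apply/eqP; rewrite eq_le; apply/andP; split.
  by apply: spectral_radius_le => // z; exact: invariant_norm_eigenvalue_le1.
have [z Az z1] := invariant_norm_large_eigenvalue SA.
exact: le_trans (eigenvalue_le_spectral_radius Az).
Qed.

End InvariantNorm.

End Main.

Theorem theorem3 (R : realType) (d : nat) (d_gt0 : (0 < d)%N)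
    (S : set 'M[R]_d) (S_closed : closed S)
    (S_semigroup : matrix_semigroup S) (S_irreducible : irreducible_family S) :
  constant_spectral_radius S <->
  exists (T : 'M[R]_d) (x : 'cV[R]_d),
    [/\ T \in unitmx,
        euclidean_norm x = 1 &
        forall A : 'M[R]_d, S A -> euclidean_norm (invmx T *m A *m T *m x) = 1].
Proof.
case: d d_gt0 S S_closed S_semigroup S_irreducible => // n _ S clS sS irrS.
split=> [csr|[T [x [TU _ Sx1]]]]; last first.
  exact: (invariant_norm_constant_spectral_radius sS irrS TU Sx1).
(* For empty S any unit vector works. *)
have [S0|/set0P[A SA]] := eqVneq S set0; last first.
  exact: (constant_spectral_radius_invariant_norm clS sS irrS SA).
exists 1%:M, (delta_mx 0 0); split; [exact: unitmx1| |by move=> A; rewrite S0].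
apply/euclidean_norm_eq1; rewrite /frob trmx_delta mul_delta_mx.
by rewrite /mxtrace big_ord1 mxE.
Qed.
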